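(* Let $G$ be a graph admitting a simultaneous $s$-stack $q$-queue layout. Then $G$ has pathwidth at most $2sq$.
   Context: All graphs are finite, simple and undirected. A vertex order $\sigma$ is a total order of the vertices. Two edges $(u,v)$ and $(x,y)$ cross with respect to $\sigma$ if $u <_\sigma x <_\sigma v <_\sigma y$, and nest if $u <_\sigma x <_\sigma y <_\sigma v$. A simultaneous $s$-stack $q$-queue layout of $G$ is a single vertex order $\sigma$ together with a partition of $E(G)$ into $s$ sets of pairwise non-crossing edges (stacks) and a partition of $E(G)$ into $q$ sets of pairwise non-nested edges (queues), both with respect to $\sigma$. Pathwidth is the minimum width (maximum bag size minus one) of a path decomposition. *)

(* Defs.v *)
From mathcomp Require Import all_boot.
From mathcomp Require Import boolp.

Set Implicit Arguments.
Unset Strict Implicit.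
Unset Printing Implicit Defensive.

(* A finite simple graph is a symmetric irreflexive relation [e] on a finite
   vertex type [T]. An undirected edge is the two-element set of its ends. *)
Definition edge_set (T : finType) (e : rel T) : {set {set T}} :=
  [set [set u; v] | u in T, v in T & e u v].

Definition vertex_order (T : finType) (le : rel T) : Prop :=
  [/\ reflexive le, antisymmetric le, transitive le & total le].

Definition strict (T : finType) (le : rel T) : rel T :=
  [rel u v | (u != v) && le u v].

(* An edge [[set u; v]] gives both pairs (u, v) and (v, u); the order
   constraints below select the pair with the smaller end first. *)
Definition cross (T : finType) (le : rel T) (u v x y : T) : bool :=
  [&& strict le u x, strict le x v & strict le v y].

Definition nest (T : finType) (le : rel T) (u v x y : T) : bool :=
  [&& strict le u x, strict le x y & strict le y v].

Definition is_stack (T : finType) (le : rel T) (A : {set {set T}}) : Prop :=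
  forall u v x y : T,
    [set u; v] \in A -> [set x; y] \in A -> ~~ cross le u v x y.

Definition is_queue (T : finType) (le : rel T) (A : {set {set T}}) : Prop :=
  forall u v x y : T,
    [set u; v] \in A -> [set x; y] \in A -> ~~ nest le u v x y.

(* Parts may be empty, unlike in [finset.partition]: an [s]-stack layout need
   not use all of its [s] stacks. *)
Definition edge_partition (T : finType) (e : rel T) (k : nat)
    (P : 'I_k -> {set {set T}}) : Prop :=
  \bigcup_(i < k) P i = edge_set e /\
  (forall i j : 'I_k, i != j -> [disjoint P i & P j]).

Definition has_simultaneous_layout (T : finType) (e : rel T) (s q : nat) : Prop :=
  exists (le : rel T) (S : 'I_s -> {set {set T}}) (Q : 'I_q -> {set {set T}}),
    [/\ vertex_order le,
        edge_partition e S, (forall i : 'I_s, is_stack le (S i)),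
        edge_partition e Q & (forall j : 'I_q, is_queue le (Q j))].

Definition path_decomposition (T : finType) (e : rel T)
    (B : seq {set T}) : Prop :=
  [/\ (forall v : T, exists2 X : {set T}, X \in B & v \in X),
      (forall u v : T, e u v ->
         exists2 X : {set T}, X \in B & (u \in X) && (v \in X)) &
      (forall (v : T) (i j k : nat), i <= j -> j <= k -> k < size B ->
         v \in nth set0 B i -> v \in nth set0 B k -> v \in nth set0 B j)].

(* The predecessor is truncated, so the graph without vertices gets width 0
   instead of -1; all other graphs are unaffected. *)
Definition width (T : finType) (B : seq {set T}) : nat :=
  (\max_(X <- B) #|X|).-1.

Lemma ex_path_decomposition_width (T : finType) (e : rel T) :
  exists w : nat,
    `[< exists2 B : seq {set T}, path_decomposition e B & width B = w >].
Proof.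
exists (width [:: [set: T]]); apply/asboolP; exists [:: [set: T]] => //; split.
- by move=> v; exists [set: T]; rewrite ?inE.
- by move=> u v _; exists [set: T]; rewrite ?inE.
- by move=> v i j [|//] _; rewrite leqn0 => /eqP -> _ _; rewrite inE.
Qed.

Definition pathwidth (T : finType) (e : rel T) : nat :=
  ex_minn (ex_path_decomposition_width e).

(* Main.v *)
Require Import Defs.
From mathcomp Require Import all_boot.
From mathcomp Require Import zify.
From mathcomp Require boolp.

Set Implicit Arguments.
Unset Strict Implicit.
Unset Printing Implicit Defensive.

(** Fix a cut of the vertex order. Two edges over the cut that lie in the same
stack and in the same queue neither cross nor nest, so they have the same left
end or the same right end. Hence the edges over the cut in one of the [s * q]
stack-queue classes form a star, and the centres of these stars are a vertex
cover, of size at most [s * q], of all the edges over the cut. The bag of a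
vertex consists of the vertex and of the covers of the cuts just before and
just after it, so it has at most [2 * s * q + 1] elements. The bags containing
a given vertex are consecutive because a star centre remains one when the cut
moves towards it, provided that a star with a single edge always has its left
end as centre. *)

(** * From covers of the cuts to a path decomposition *)

Lemma pathwidth_le (T : finType) (e : rel T) (B : seq {set T}) (w : nat) :
  path_decomposition e B -> (forall X, X \in B -> #|X| <= w.+1) ->
  pathwidth e <= w.
Proof.
move=> dB leB; rewrite /pathwidth; case: ex_minnP => m _ min_m.
apply: (@leq_trans (width B)).
  by apply: min_m; apply/boolp.asboolP; exists B.
have: \max_(X <- B) #|X| <= w.+1 by apply/bigmax_leqP_seq => X XB _; apply: leB.
rewrite /width; lia.
Qed.

(** [C p] covers the edges over the cut between the positions [p.-1] and [p]. *)
Lemma pathwidth_le_cut_covers (T : finType) (e : rel T) (pos : T -> nat)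
    (C : nat -> {set T}) (k : nat) :
  symmetric e -> irreflexive e -> injective pos ->
  (forall p u v, e u v -> pos u < p <= pos v -> (u \in C p) || (v \in C p)) ->
  (forall p p' v, v \in C p -> pos v < p' <= p -> v \in C p') ->
  (forall p p' v, v \in C p -> p <= p' <= pos v -> v \in C p') ->
  (forall p, #|C p| <= k) ->
  pathwidth e <= 2 * k.
Proof.
move=> e_sym e_irr pos_inj coverC leftC rightC cardC.
pose bag (p : nat) := [set v | pos v == p] :|: (C p :|: C p.+1).
pose n := (\max_v pos v).+1.
have pos_lt v : pos v < n by rewrite ltnS leq_bigmax.
have bagE (p : nat) v : (v \in bag p) = [|| pos v == p, v \in C p | v \in C p.+1].
  by rewrite !inE.
have bag_in p : p < n -> bag p \in mkseq bag n.
  by move=> pn; apply/mapP; exists p => //; rewrite mem_iota.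
apply: (@pathwidth_le _ _ (mkseq bag n)); last first.
  move=> _ /mapP[p _ ->].
  have: #|[set v | pos v == p]| <= 1.
    apply/card_le1_eqP => u v; rewrite !inE => /eqP pu /eqP pv.
    by apply: pos_inj; rewrite pu.
  have := cardC p; have := cardC p.+1.
  have := leq_of_leqif (leq_card_setU [set v | pos v == p] (C p :|: C p.+1)).
  have := leq_of_leqif (leq_card_setU (C p) (C p.+1)).
  rewrite /bag; lia.
split.
- by move=> v; exists (bag (pos v)); rewrite ?bag_in // bagE eqxx.
- suff edge_bag u v : e u v -> pos u < pos v ->
      exists2 X, X \in mkseq bag n & (u \in X) && (v \in X).
    move=> u v euv; case: (ltngtP (pos u) (pos v)) => [|lt_vu|/pos_inj uv].
    + exact: edge_bag.
    + have [|X XB] := edge_bag v u _ lt_vu; first by rewrite e_sym.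
      by rewrite andbC; exists X.
    + by rewrite uv e_irr in euv.
  move=> euv lt_uv.
  have [uC|uC] := boolP (u \in C (pos v)).
    by exists (bag (pos v)); rewrite ?bag_in // !bagE uC eqxx orbT.
  (* Take the least cut [p.+1] after [u] whose cover contains [v]. Either [p] is the position of
     [u], or the cut [p] still separates [u] from [v] and minimality forces [u] into [C p]. Both
     ends then lie in [bag p]. *)
  have exp : exists p, (pos u < p) && (v \in C p).
    exists (pos v); rewrite lt_uv.
    by have := coverC (pos v) _ _ euv; rewrite (negbTE uC) lt_uv leqnn; apply.
  case: (ex_minnP exp) => -[|p] /andP[]; rewrite // ltnS => le_up vC min_p.
  have le_pv : p < pos v.
    apply: min_p; rewrite lt_uv.
    by have := coverC (pos v) _ _ euv; rewrite (negbTE uC) lt_uv leqnn; apply.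
  exists (bag p); first by rewrite bag_in // (ltn_trans le_pv).
  rewrite !bagE vC !orbT andbT.
  move: le_up; rewrite leq_eqVlt => /orP[-> // | lt_up].
  have /orP[-> | vCp] : (u \in C p) || (v \in C p).
  - by apply: coverC => //; rewrite lt_up ltnW.
  - by rewrite orbT.
  - by have := min_p p; rewrite lt_up vCp ltnn => /(_ isT).
- move=> v i j k' le_ij le_jk; rewrite size_mkseq => lt_kn.
  rewrite !nth_mkseq ?bagE; try lia.
  (* Past [v], membership in the later bag comes from a cover, and [leftC] carries it back to [C j].
     Before [v], [rightC] carries membership in the earlier bag forward to [C j.+1]. *)
  move=> v_i v_k; case: (ltngtP (pos v) j) => //= [lt_vj|lt_jv].
  + have vCj p : j <= p -> v \in C p -> v \in C j.
      by move=> le_jp vC; apply: leftC vC _; rewrite lt_vj.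
    case/or3P: v_k => [|/vCj->//|/vCj->//]; lia.
  + have vCj p : p <= j.+1 -> v \in C p -> v \in C j.+1.
      by move=> le_jp vC; apply: rightC vC _; rewrite le_jp.
    case/or3P: v_i => [|/vCj->|/vCj->]; rewrite ?orbT //; lia.
Qed.

(** * Centres of stars *)

Section StarCentre.
Variables (T : finType) (F : rel T).

(** A set, so that it can be empty. The existence conjunct empties it when [F] holds nowhere, where
    the other conjunct is vacuous. *)
Definition left_centre : {set T} :=
  [set u | [exists w, F u w] && [forall x, forall y, F x y ==> (x == u)]].

Definition right_centre : {set T} :=
  [set w | [exists u, F u w] && [forall x, forall y, F x y ==> (y == w)]].

Definition centre : {set T} :=
  if left_centre == set0 then right_centre else left_centre.

Lemma left_centreP u :
  reflect ((exists w, F u w) /\ forall x y, F x y -> x = u) (u \in left_centre).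
Proof.
rewrite inE; apply: (iffP andP) => -[exF allF]; split; try exact/existsP.
  by move=> x y Fxy; move/forallP/(_ x)/forallP/(_ y): allF; rewrite Fxy => /eqP.
by apply/forallP => x; apply/forallP => y; apply/implyP => /allF ->.
Qed.

Lemma right_centreP w :
  reflect ((exists u, F u w) /\ forall x y, F x y -> y = w)
    (w \in right_centre).
Proof.
rewrite inE; apply: (iffP andP) => -[exF allF]; split; try exact/existsP.
  by move=> x y Fxy; move/forallP/(_ x)/forallP/(_ y): allF; rewrite Fxy => /eqP.
by apply/forallP => x; apply/forallP => y; apply/implyP => /allF ->.
Qed.

Lemma card_centre : #|centre| <= 1.
Proof.
rewrite /centre; case: ifP => _; apply/card_le1_eqP => u v.
  by move=> /right_centreP[[x Fxu] _] /right_centreP[_ /(_ _ _ Fxu)].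
by move=> /left_centreP[[x Fux] _] /left_centreP[_ /(_ _ _ Fux)].
Qed.

(** Two pairs with different right ends share their left end [u]. A third pair with another left end
    would have to end at both right ends, so [u] is a left centre. *)
Lemma centre_cover u w :
  (forall x y x' y', F x y -> F x' y' -> x = x' \/ y = y') ->
  F u w -> (u \in centre) || (w \in centre).
Proof.
move=> shareF Fuw; rewrite /centre; case: eqP => [L0|/eqP/set0Pn[v vL]].
  suff -> : w \in right_centre by rewrite orbT.
  apply/right_centreP; split=> [|x y Fxy]; first by exists u.
  apply/eqP; apply/negP => /negP ne_yw.
  have xu : x = u by case: (shareF _ _ _ _ Fxy Fuw) => // /eqP; rewrite (negbTE ne_yw).
  subst x; suff: u \in left_centre by rewrite L0 inE.
  apply/left_centreP; split=> [|x' y' F']; first by exists w.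
  case: (shareF _ _ _ _ F' Fuw) => // y'w.
  case: (shareF _ _ _ _ F' Fxy) => // y'y.
  by rewrite -y'w -y'y eqxx in ne_yw.
by case/left_centreP: (vL) => _ /(_ _ _ Fuw) ->; rewrite vL.
Qed.

End StarCentre.

Lemma leq_card_bigcup (I T : finType) (A : I -> {set T}) (k : nat) :
  (forall i, #|A i| <= k) -> #|\bigcup_i A i| <= #|I| * k.
Proof.
move=> leA; rewrite -sum_nat_const.
elim/big_ind2: _ => [|m X n Y leX leY|i _]; rewrite ?cards0 //.
by rewrite (leq_trans (leq_card_setU _ _)) // leq_add.
Qed.

(** * One stack-queue class as the cut moves *)

Section Class.
Variables (T : finType) (pos : T -> nat) (E : {set {set T}}).
Hypothesis pos_inj : injective pos.
Hypothesis no_cross : forall u v x y,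
  [set u; v] \in E -> [set x; y] \in E ->
  ~~ [&& pos u < pos x, pos x < pos v & pos v < pos y].
Hypothesis no_nest : forall u v x y,
  [set u; v] \in E -> [set x; y] \in E ->
  ~~ [&& pos u < pos x, pos x < pos y & pos y < pos v].

Definition over (p : nat) : rel T :=
  [rel u w | ([set u; w] \in E) && (pos u < p <= pos w)].

(** The cut puts both left ends before both right ends. If the ends differ on both sides, equal
    orders on the two sides give a crossing and opposite orders a nesting. *)
Lemma over_share p u w x y : over p u w -> over p x y -> u = x \/ w = y.
Proof.
move=> /andP[uw /andP[lt_up le_pw]] /andP[xy /andP[lt_xp le_py]].
have := no_cross uw xy; have := no_cross xy uw.
have := no_nest uw xy; have := no_nest xy uw.
case: (ltngtP (pos u) (pos x)) => [lt_ux|lt_xu|/pos_inj]; last by left.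
all: case: (ltngtP (pos w) (pos y)) => [lt_wy|lt_yw|/pos_inj]; last by right.
all: lia.
Qed.

(** Being before the cut, [v] is a left centre. An edge over [p'] that ends before [p] cannot share
    its right end with an edge over [p], so it starts at [v]. *)
Lemma centre_over_left p p' v :
  v \in centre (over p) -> pos v < p' <= p -> v \in centre (over p').
Proof.
move=> + /andP[lt_vp' le_p'p]; rewrite /centre; case: ifP => _.
  by case/right_centreP => -[u /andP[_ /andP[_ le_pv]]] _; lia.
case/left_centreP => -[w vw] allv.
have vL : v \in left_centre (over p').
  apply/left_centreP; split.
    by exists w; move: vw => /andP[vw /andP[_ le_pw]]; apply/andP; split=> //; lia.
  move=> x y xy; have [lt_yp|le_py] := ltnP (pos y) p.
    case/andP: xy => xy /andP[lt_xp' le_p'y]; case/andP: vw => vw /andP[_ le_pw].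
    have vw' : over p' v w by apply/andP; split=> //; lia.
    have xy' : over p' x y by apply/andP; split=> //; lia.
    by case: (over_share xy' vw') => // yw; move: lt_yp; rewrite yw; lia.
  by apply: (allv _ y); case/andP: xy => xy xp; apply/andP; split=> //; lia.
by case: eqP => // L0; rewrite L0 inE in vL.
Qed.

Lemma centre_over_right p p' v :
  v \in centre (over p) -> p <= p' <= pos v -> v \in centre (over p').
Proof.
move=> + /andP[le_pp' le_p'v]; rewrite /centre; case: ifP => [/eqP L0|_]; last first.
  by case/left_centreP => -[w /andP[_ /andP[lt_vp _]]] _; lia.
case/right_centreP => -[u uv] allv.
have up u' : over p u' v -> over p' u' v.
  by case/andP => u'v /andP[lt_u'p _]; apply/andP; split=> //; lia.
(* Here the preference for left centres matters. All edges over [p] end at [v] and stay over [p'],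
   so a left centre [x] at [p'] would already be one at [p], contradicting [L0]. *)
case: eqP => [_|/eqP/set0Pn[x /left_centreP[_ allx]]].
  apply/right_centreP; split; first by exists u; apply: up.
  move=> x y xy; have [lt_xp|le_px] := ltnP (pos x) p.
    by apply: (allv x); case/andP: xy => xy xp; apply/andP; split=> //; lia.
  case: (over_share xy (up _ uv)) => // xu.
  by case/andP: uv => _; rewrite -xu; lia.
suff: u \in left_centre (over p) by rewrite L0 inE.
apply/left_centreP; split=> [|x' y' x'y']; first by exists v.
have y'v := allv _ _ x'y'; rewrite y'v in x'y'.
by rewrite (allx _ _ (up _ x'y')) (allx _ _ (up _ uv)).
Qed.

End Class.

(** * Numerical positions and the final assembly *)

Lemma vertex_order_pos (T : finType) (le : rel T) :
  vertex_order le ->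
  exists2 pos : T -> nat, injective pos &
    forall u v, strict le u v = (pos u < pos v).
Proof.
case=> le_refl le_anti le_trans le_total.
(* The position of a vertex is the number of its strict predecessors. *)
pose below v := [set u | strict le u v].
have lt_pos u v : strict le u v -> #|below u| < #|below v|.
  move=> /andP[ne_uv le_uv]; apply/proper_card/properP; split; last first.
    by exists u; rewrite inE /strict /= ?eqxx ?ne_uv.
  apply/subsetP => x; rewrite !inE /strict /= => /andP[ne_xu le_xu].
  rewrite (le_trans _ _ _ le_xu le_uv) andbT; apply: contraNneq ne_uv => xv.
  by apply/eqP/le_anti; rewrite le_uv -xv.
have strict_total u v : u != v -> strict le u v || strict le v u.
  by move=> ne_uv; rewrite /strict /= ne_uv eq_sym ne_uv le_total.
exists (fun v => #|below v|) => [u v eq_uv|u v].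
  apply/eqP; apply: contraT => /strict_total /orP[] /lt_pos;
  by rewrite eq_uv ltnn.
apply/idP/idP => [/lt_pos //|lt_uv].
have ne_uv : u != v by apply: contraTneq lt_uv => ->; rewrite ltnn.
by case/orP: (strict_total _ _ ne_uv) => // /lt_pos; lia.
Qed.

Theorem theorem2 (T : finType) (e : rel T) (s q : nat)
    (e_sym : symmetric e) (e_irr : irreflexive e)
    (layout : has_simultaneous_layout e s q) :
  pathwidth e <= 2 * s * q.
Proof.
case: layout => le [S [Q [le_order [S_cover _] S_stack [Q_cover _] Q_queue]]].
have [pos pos_inj strictE] := vertex_order_pos le_order.
pose E (c : 'I_s * 'I_q) := S c.1 :&: Q c.2.
have no_cross c u v x y : [set u; v] \in E c -> [set x; y] \in E c ->
    ~~ [&& pos u < pos x, pos x < pos v & pos v < pos y].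
  rewrite !inE => /andP[uv _] /andP[xy _].
  by rewrite -!strictE; apply: S_stack uv xy.
have no_nest c u v x y : [set u; v] \in E c -> [set x; y] \in E c ->
    ~~ [&& pos u < pos x, pos x < pos y & pos y < pos v].
  rewrite !inE => /andP[_ uv] /andP[_ xy].
  by rewrite -!strictE; apply: Q_queue uv xy.
pose C p := \bigcup_c centre (over pos (E c) p).
rewrite -mulnA; apply: (pathwidth_le_cut_covers (C := C) e_sym e_irr pos_inj).
- move=> p u v euv u_p_v.
  have uvE : [set u; v] \in edge_set e by apply/imset2P; exists u v; rewrite ?inE.
  have /bigcupP[i _ uvS] : [set u; v] \in \bigcup_(i < s) S i by rewrite S_cover.
  have /bigcupP[j _ uvQ] : [set u; v] \in \bigcup_(j < q) Q j by rewrite Q_cover.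
  have uv_over : over pos (E (i, j)) p u v by rewrite /over /= u_p_v in_setI uvS uvQ.
  have := centre_cover (@over_share _ _ _ pos_inj (@no_cross _) (@no_nest _) p) uv_over.
  by case/orP => vC; apply/orP; [left | right]; apply/bigcupP; exists (i, j).
- move=> p p' v /bigcupP[c _ vC] v_p'_p; apply/bigcupP; exists c => //.
  exact: (centre_over_left pos_inj (@no_cross c) (@no_nest c) vC).
- move=> p p' v /bigcupP[c _ vC] p_p'_v; apply/bigcupP; exists c => //.
  exact: (centre_over_right pos_inj (@no_cross c) (@no_nest c) vC).
(* Each of the [s * q] classes contributes at most one centre. *)
- move=> p; have := leq_card_bigcup (fun c => card_centre (over pos (E c) p)).
  by rewrite card_prod !card_ord muln1.
Qed.
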